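(* Let $G$ be a simple graph on $n\geq 1$ vertices with no null vertex and let $F=\{f_i\}_{i\in[n]}$ be a $G(n,k)$-frame for $\mathbb{C}^k$. Then $F$ is a tight frame if and only if $G$ has exactly two distinct eigenvalues.
   Context: $[n]=\{1,\dots,n\}$. A sequence $\{f_i\}_{i\in[n]}$ in $\mathbb{C}^k$ is a frame for $\mathbb{C}^k$ if there are constants $A,B>0$ with $A\|f\|^2\le\sum_{i\in[n]}|\langle f,f_i\rangle|^2\le B\|f\|^2$ for all $f\in\mathbb{C}^k$; it is a tight frame if one can take $A=B$. Its Gramian matrix is the $n\times n$ matrix whose $(i,j)$ entry is $\langle f_j,f_i\rangle$ (inner product linear in the first argument). The Laplacian matrix of a simple graph $G$ with vertices $v_1,\dots,v_n$ is $L(G)=D(G)-A(G)$, where $D(G)$ is the diagonal matrix of vertex degrees and $A(G)$ is the adjacency matrix. A frame $\{f_i\}_{i\in[n]}$ for $\mathbb{C}^k$ is a $G(n,k)$-frame if its Gramian matrix equals $L(G)$. A null vertex is a vertex of degree $0$. The eigenvalues of a graph $G$ are the eigenvalues of its adjacency matrix $A(G)$. *)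

(* Defs.v *)
From HB Require Import structures.
From mathcomp Require Import all_boot all_order all_algebra.
From mathcomp Require Import complex reals.

Set Implicit Arguments.
Unset Strict Implicit.
Unset Printing Implicit Defensive.

Import Order.TTheory GRing.Theory Num.Theory.
Local Open Scope ring_scope.
Local Open Scope complex_scope.

(* A simple graph on n vertices is a symmetric irreflexive adjacency relation
   on 'I_n. *)
Definition simple_graph (n : nat) (e : rel 'I_n) : Prop :=
  symmetric e /\ irreflexive e.

Definition degree (n : nat) (e : rel 'I_n) (v : 'I_n) : nat := #|[set w | e v w]|.

Definition null_vertex (n : nat) (e : rel 'I_n) (v : 'I_n) : Prop :=
  degree e v = 0%N.

Definition adjacency_mx (K : pzRingType) (n : nat) (e : rel 'I_n) : 'M[K]_n :=
  \matrix_(i, j) (e i j)%:R.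

Definition degree_mx (K : pzRingType) (n : nat) (e : rel 'I_n) : 'M[K]_n :=
  diag_mx (\row_i (degree e i)%:R).

Definition laplacian_mx (K : pzRingType) (n : nat) (e : rel 'I_n) : 'M[K]_n :=
  degree_mx K e - adjacency_mx K e.

(* C^k is the space of row vectors 'rV[R[i]]_k. The inner product dotmx is the
   standard one, linear in its first and conjugate-linear in its second
   argument, so that dotmx f f is the squared norm of f. The order on R[i] is
   the partial one (equal imaginary parts, ordered real parts); both sides of
   the inequalities below are real. *)
Definition frame_bounds (R : realType) (n k : nat) (F : 'I_n -> 'rV[R[i]]_k)
    (A B : R) : Prop :=
  forall f : 'rV[R[i]]_k,
    A%:C * dotmx f f <= \sum_(i < n) `|dotmx f (F i)| ^+ 2 <= B%:C * dotmx f f.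

Definition is_frame (R : realType) (n k : nat) (F : 'I_n -> 'rV[R[i]]_k) : Prop :=
  exists A B : R, [/\ 0 < A, 0 < B & frame_bounds F A B].

Definition is_tight_frame (R : realType) (n k : nat) (F : 'I_n -> 'rV[R[i]]_k) :
    Prop :=
  exists A : R, 0 < A /\ frame_bounds F A A.

Definition gramian_mx (R : realType) (n k : nat) (F : 'I_n -> 'rV[R[i]]_k) :
    'M[R[i]]_n :=
  \matrix_(i, j) dotmx (F j) (F i).

Definition graph_frame (R : realType) (n k : nat) (e : rel 'I_n)
    (F : 'I_n -> 'rV[R[i]]_k) : Prop :=
  is_frame F /\ gramian_mx F = laplacian_mx R[i] e.

Definition graph_eigenvalue (R : realType) (n : nat) (e : rel 'I_n) (a : R[i]) :
    Prop :=
  eigenvalue (adjacency_mx R[i] e) a.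

Definition two_distinct_eigenvalues (R : realType) (n : nat) (e : rel 'I_n) : Prop :=
  exists a b : R[i],
    a != b /\ forall c : R[i], graph_eigenvalue e c <-> c = a \/ c = b.

(* Main.v *)
Require Import Defs.
From mathcomp Require Import all_boot all_order all_algebra.
From mathcomp Require Import complex reals.

(** Both properties are equivalent to an identity L^2 = c L for the Laplacian L,
    with c > 0.

    For the frame, let T be the n x k matrix with rows f_i. The Gramian is the
    transpose of T T^*, while the frame operator is S = T^* T, and
    sum_i |<f, f_i>|^2 = <f S, f>. So tightness with bound c says that the
    hermitian matrix S - c has a vanishing quadratic form, that is, S = c
    ([hermitian_form_eq0], [frame_bounds_frame_op]). Since (T T^* )^2 = T S T^*,
    S = c gives L^2 = c L; conversely, L^2 = c L gives S^3 = c S^2, and S can be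
    cancelled because the lower frame bound makes it invertible
    ([frame_op_scalar]).

    For the graph, either property forces regularity, as seen on diagonals.
    If L^2 = c L, the entry at a vertex of degree d reads d^2 + d = c d, so
    d = c - 1. If the adjacency matrix A has no eigenvalue outside {a, b}, it
    satisfies (A - a)(A - b) = 0 because it is diagonalizable, and the diagonal
    of A^2 = (a + b) A - a b reads d = - a b. Once the graph is d-regular,
    L = d - A, and L^2 = (d + 1) L becomes (A - d)(A + 1) = 0
    ([laplacian_sqr_regular]). This identity confines the spectrum to {d, -1};
    both values occur, d for the all-ones vector and -1 for the nonzero rows of
    A - d. In the other direction d is one of a and b, and a b = - d makes the
    other one -1. *)

Set Implicit Arguments.
Unset Strict Implicit.
Unset Printing Implicit Defensive.

Import Order.TTheory GRing.Theory Num.Theory.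
Local Open Scope ring_scope.
Local Open Scope complex_scope.
Local Open Scope sesquilinear_scope.

(** * Matrices annihilated by a quadratic polynomial *)

Lemma mulmx_sub_scalar (C : comNzRingType) (n : nat) (M : 'M[C]_n) (a b : C) :
  (M - a%:M) *m (M - b%:M) = M *m M - (a + b) *: M + (a * b)%:M.
Proof.
rewrite mulmxBl !mulmxBr mul_mx_scalar !mul_scalar_mx scale_scalar_mx scalerDl.
by rewrite opprB opprD !addrA [LHS]addrAC; congr (_ + _); exact: addrAC.
Qed.

Lemma eigenvalue_of_sub_mul0 (K : fieldType) (n : nat) (M : 'M[K]_n) (a b x : K) :
  (M - a%:M) *m (M - b%:M) = 0 -> eigenvalue M x -> x = a \/ x = b.
Proof.
move=> M0 /eigenvalueP[v vM v_neq0].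
have vB c : v *m (M - c%:M) = (x - c) *: v.
  by rewrite mulmxBr vM mul_mx_scalar scalerBl.
have : v *m ((M - a%:M) *m (M - b%:M)) = 0 by rewrite M0 mulmx0.
rewrite mulmxA vB -scalemxAl vB => /eqP.
rewrite !scaler_eq0 (negPf v_neq0) orbF !subr_eq0.
by case/orP=> /eqP; [left | right].
Qed.

(** The spectral theorem turns the product into a diagonal matrix whose entries
    are (x - a)(x - b) for eigenvalues x. *)
Lemma normalmx_sub_mul0 (C : numClosedFieldType) (n : nat) (M : 'M[C]_n) (a b : C) :
  M \is normalmx -> (forall x, eigenvalue M x -> x = a \/ x = b) ->
  (M - a%:M) *m (M - b%:M) = 0.
Proof.
move=> /orthomx_spectralP; set P := spectralmx M; set s := spectral_diag M => ME ab.
have Pu : P \in unitmx by exact: spectral_unit.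
have ME' : P *m M = diag_mx s *m P.
  by rewrite [in LHS]ME !mulmxA mulmxV // mul1mx.
have PB c : P *m (M - c%:M) = diag_mx (s - const_mx c) *m P.
  by rewrite mulmxBr ME' raddfB /= diag_const_mx mulmxBl mul_mx_scalar mul_scalar_mx.
apply: (can_inj (mulKmx Pu)).
rewrite mulmx0 mulmxA PB -mulmxA PB mulmxA mulmx_diag.
suff -> : \row_j ((s - const_mx a) 0 j * (s - const_mx b) 0 j) = 0.
  by rewrite raddf0 mul0mx.
apply/rowP=> j; rewrite !mxE.
have /ab : eigenvalue M (s 0 j).
  apply/eigenvalueP; exists (row j P).
    by rewrite -row_mul ME' row_mul row_diag_mx -scalemxAl -rowE.
  by apply: contraTneq Pu => Pj0; rewrite -row_free_unit; apply/row_freePn;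
     exists j; rewrite Pj0 sub0mx.
by case=> ->; rewrite subrr (mul0r, mulr0).
Qed.

(** Polarization at f and f M: as M is hermitian, both cross terms of the
    quadratic form at f + f M equal |f M|^2. *)
Lemma hermitian_form_eq0 (C : numClosedFieldType) (n : nat) (M : 'M[C]_n) :
  M^t* = M -> (forall f : 'rV[C]_n, dotmx (f *m M) f = 0) -> M = 0.
Proof.
move=> Mh M0; apply/row_matrixP=> i; rewrite row0 rowE.
set f := delta_mx _ _ : 'rV_n; set g := f *m M.
have fg : dotmx (g *m M) f = dotmx g g.
  by rewrite !dotmxE /g trmx_mul map_mxM Mh !mulmxA.
have := M0 (f + g); rewrite mulmxDl linearDl /= !linearDr /= !M0 fg add0r addr0.
rewrite -/g -mulr2n => /eqP; rewrite mulrn_eq0 /= dnorm_eq0.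
by move/eqP.
Qed.

(** * Frames *)

Section Frames.
Variables (R : realType) (n k : nat) (F : 'I_n -> 'rV[R[i]]_k).

Definition analysis_mx : 'M[R[i]]_(n, k) := \matrix_i F i.

Definition frame_op : 'M[R[i]]_k := analysis_mx^t* *m analysis_mx.

Lemma frame_op_herm : frame_op^t* = frame_op.
Proof. by rewrite /frame_op trmx_mul map_mxM trmxCK. Qed.

Lemma gramian_mxE : gramian_mx F = (analysis_mx *m analysis_mx^t*)^T.
Proof.
apply/matrixP=> i j; rewrite mxE dotmxE !mxE; apply: eq_bigr => l _.
by rewrite !mxE.
Qed.

Lemma sum_dotmx_frame_op (f : 'rV[R[i]]_k) :
  \sum_(i < n) `|dotmx f (F i)| ^+ 2 = dotmx (f *m frame_op) f.
Proof.
have -> : dotmx (f *m frame_op) f = dotmx (f *m analysis_mx^t*) (f *m analysis_mx^t*).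
  by rewrite !dotmxE trmx_mul map_mxM trmxCK !mulmxA.
rewrite dotmxE mxE; apply: eq_bigr => i _; rewrite normCK.
suff -> : dotmx f (F i) = (f *m analysis_mx^t*) 0 i by rewrite !mxE.
by rewrite dotmxE !mxE; apply: eq_bigr => l _; rewrite !mxE.
Qed.

(** A vector killed by the frame operator violates the lower frame bound unless
    it is zero. *)
Lemma frame_op_unit : is_frame F -> frame_op \in unitmx.
Proof.
case=> A [B [A_gt0 _ FAB]]; rewrite -row_free_unit -kermx_eq0.
apply/eqP/row_matrixP=> i; rewrite row0; apply/eqP.
set f := row i _.
have fS0 : f *m frame_op = 0 by rewrite /f -row_mul mulmx_ker row0.
have /andP[+ _] := FAB f.
rewrite sum_dotmx_frame_op fS0 linear0l; apply: contraTT => f_neq0.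
rewrite -real_ltNge ?realE ?lexx //.
  by rewrite mulr_gt0 ?dnorm_gt0 // ltcR.
by rewrite mulr_ge0 ?dnorm_ge0 // lecR ltW.
Qed.

Lemma frame_bounds_frame_op (c : R) :
  frame_bounds F c c <-> frame_op = c%:C%:M.
Proof.
split=> [Fc | Sc f]; last first.
  by rewrite sum_dotmx_frame_op Sc mul_mx_scalar linearZl_LR /= lexx.
apply/eqP; rewrite -subr_eq0; apply/eqP; apply: hermitian_form_eq0.
  rewrite linearB map_mxB /= frame_op_herm tr_scalar_mx map_scalar_mx.
  by rewrite (_ : _ c%:C = c%:C) //; apply: CrealP; rewrite realE lecR lecR le_total.
move=> f; rewrite mulmxBr linearBl /= mul_mx_scalar linearZl_LR /=.
apply/eqP; rewrite subr_eq0 eq_le andbC -sum_dotmx_frame_op.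
exact: Fc.
Qed.

(** The Gramian, up to transposition T T^*, has the same nonzero spectrum as the
    frame operator T^* T. The quadratic relation passes from one to the other, and
    the invertibility of the frame operator rules out the root 0. *)
Lemma frame_op_scalar (c : R[i]) : is_frame F ->
  frame_op = c%:M <-> gramian_mx F *m gramian_mx F = c *: gramian_mx F.
Proof.
move=> /frame_op_unit Su; rewrite gramian_mxE -trmx_mul -linearZ /=.
set T := analysis_mx.
have TT : T *m T^t* *m (T *m T^t*) = T *m frame_op *m T^t*.
  by rewrite /frame_op !mulmxA.
rewrite TT; split=> [-> | /trmx_inj TSc].
  by rewrite mul_mx_scalar -scalemxAl.
(* Multiply the relation for T T^* by T^* on the left and by T on the right. *)
have : frame_op *m frame_op *m frame_op = frame_op *m c%:M *m frame_op.
  rewrite {1 3 4 5}/frame_op -!mulmxA -/T; congr (_ *m _).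
  rewrite mul_scalar_mx -scalemxAr; rewrite !mulmxA -(mulmxA T) TSc.
  by rewrite -scalemxAl mulmxA.
by move=> /(can_inj (mulmxK Su)) /(can_inj (mulKmx Su)).
Qed.

Lemma tight_frame_gramian_sq : is_frame F ->
  is_tight_frame F <->
  exists c : R, 0 < c /\ gramian_mx F *m gramian_mx F = c%:C *: gramian_mx F.
Proof.
move=> Ff; split=> -[c [c_gt0 H]]; exists c; split=> //.
  by apply/(frame_op_scalar _ Ff)/frame_bounds_frame_op.
by apply/frame_bounds_frame_op/(frame_op_scalar _ Ff).
Qed.

End Frames.

(** * Laplacian and adjacency matrices *)

Section Graphs.
Variables (C : numClosedFieldType) (n : nat) (e : rel 'I_n).
Hypothesis e_simple : simple_graph e.
Let A := adjacency_mx C e.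
Let L := laplacian_mx C e.

Lemma adjacency_tr : A^T = A.
Proof. by apply/matrixP=> i j; rewrite !mxE e_simple.1. Qed.

Lemma sum_adjacency i : \sum_j A i j = (degree e i)%:R.
Proof.
rewrite /degree -sum1_card natr_sum [RHS]big_mkcond /=.
by apply: eq_bigr => j _; rewrite mxE inE; case: (e i j).
Qed.

(** Closed walks of length 2 from a vertex correspond to its neighbours. *)
Lemma adjacency_sqr_diag i : (A *m A) i i = (degree e i)%:R.
Proof.
rewrite -sum_adjacency mxE; apply: eq_bigr => j _.
by rewrite !mxE e_simple.1; case: (e j i); rewrite ?mulr1 ?mulr0.
Qed.

Lemma adjacency_normal : A \is normalmx.
Proof.
apply/normalmxP; suff -> : A^t* = A by [].
by rewrite adjacency_tr; apply/matrixP=> i j; rewrite !mxE conjC_nat.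
Qed.

Lemma laplacian_diag i : L i i = (degree e i)%:R.
Proof. by rewrite !mxE e_simple.2 eqxx subr0. Qed.

Lemma laplacian_sqr_diag i :
  (L *m L) i i = (degree e i)%:R ^+ 2 + (degree e i)%:R.
Proof.
rewrite /L /laplacian_mx mulmxBl !mulmxBr /degree_mx mulmx_diag.
rewrite mul_mx_diag mul_diag_mx -/A.
have := adjacency_sqr_diag i; rewrite !mxE e_simple.2 eqxx => ->.
by rewrite !mulr0 mul0r subr0 sub0r opprK expr2.
Qed.

Section Regular.
Variable d : nat.
Hypothesis e_regular : forall v, degree e v = d.

Lemma laplacian_regular : L = - (A - d%:R%:M).
Proof.
rewrite opprB /L /laplacian_mx; congr (_ - _).
apply/matrixP=> i j; rewrite !mxE; by case: eqP => // _; rewrite e_regular.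
Qed.

(** For L = d - A, the product L (L - (d + 1)) is (A - d)(A + 1); the factor
    A + 1 is written so as to fit the general lemmas on (M - a)(M - b). *)
Lemma laplacian_sqr_regular :
  (L *m L = d.+1%:R *: L) <-> (A - d%:R%:M) *m (A - (-1)%:M) = 0.
Proof.
have -> : (A - d%:R%:M) *m (A - (-1)%:M) = L *m L - d.+1%:R *: L.
  rewrite laplacian_regular mulmxN mulNmx opprK scalerN opprK.
  rewrite -mul_mx_scalar -mulmxDr; congr (_ *m _).
  by rewrite -addrA; congr (_ + _); rewrite -natr1 raddfN raddfD /= addKr opprK.
by split=> [->|/subr0_eq]; rewrite ?subrr.
Qed.

Lemma regular_eigenvalue : (0 < n)%N -> eigenvalue A d%:R.
Proof.
move=> n_gt0; apply/eigenvalueP; exists (const_mx 1).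
  rewrite -[LHS]trmxK trmx_mul adjacency_tr; apply/rowP=> i; rewrite !mxE.
  rewrite mulr1 -(e_regular i) -sum_adjacency; apply: eq_bigr => j _.
  by rewrite !mxE mulr1.
by apply/eqP => /rowP/(_ (Ordinal n_gt0)); rewrite !mxE; apply/eqP/oner_neq0.
Qed.

End Regular.

(** The diagonal of L^2 = c L forces every degree to be c - 1. *)
Lemma two_eigenvalues_of_laplacian_sqr (c : C) : (0 < n)%N ->
  (forall v, degree e v != 0%N) -> L *m L = c *: L ->
  exists a b : C, a != b /\ forall x, eigenvalue A x <-> x = a \/ x = b.
Proof.
move=> n_gt0 deg_neq0 L2; set v0 := Ordinal n_gt0; pose d := degree e v0.
have cE i : c = (degree e i).+1%:R.
  have := congr1 (fun M : 'M_n => M i i) L2.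
  rewrite laplacian_sqr_diag [RHS]mxE laplacian_diag expr2 -[X in _ + X]mul1r.
  rewrite -mulrDl natr1 => /mulIf -> //.
  by rewrite pnatr_eq0.
have e_regular i : degree e i = d.
  by apply/eqP; rewrite -eqSS -(eqr_nat C) -!cE.
have A0 : (A - d%:R%:M) *m (A - (-1)%:M) = 0.
  by apply/laplacian_sqr_regular => //; rewrite L2 (cE v0).
exists d%:R, (-1); split=> [|x].
  by rewrite -subr_eq0 opprK natr1 pnatr_eq0.
split=> [|[]->]; first exact: eigenvalue_of_sub_mul0.
  exact: regular_eigenvalue.
(* The rows of A - d are killed by A + 1, and their diagonal entries are -d. *)
apply/eigenvalueP; exists (row v0 (A - d%:R%:M)).
  apply/eqP; rewrite -subr_eq0 -mul_mx_scalar -mulmxBr -row_mul A0 row0 //.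
apply/eqP=> /rowP/(_ v0); rewrite !mxE e_simple.2 eqxx => /eqP.
by rewrite sub0r oppr_eq0 pnatr_eq0 (negPf (deg_neq0 v0)).
Qed.

(** The diagonal of (A - a)(A - b) = 0 forces every degree to be - a b; the
    regular degree is itself an eigenvalue, which determines {a, b}. *)
Lemma laplacian_sqr_of_two_eigenvalues (a b : C) : (0 < n)%N ->
  (forall v, degree e v != 0%N) ->
  (forall x, eigenvalue A x -> x = a \/ x = b) ->
  exists d : nat, L *m L = d.+1%:R *: L.
Proof.
move=> n_gt0 deg_neq0 Aab; set v0 := Ordinal n_gt0; pose d := degree e v0.
have degE i : (degree e i)%:R = - (a * b).
  have := congr1 (fun M : 'M_n => M i i) (normalmx_sub_mul0 adjacency_normal Aab).
  rewrite mulmx_sub_scalar !mxE eqxx e_simple.2 mulr0 subr0 mulr1n => /eqP.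
  have := adjacency_sqr_diag i; rewrite mxE => ->.
  by rewrite addr_eq0 => /eqP.
have e_regular i : degree e i = d.
  by apply/eqP; rewrite -(eqr_nat C) !degE.
have d_neq0 : d%:R != 0 :> C by rewrite pnatr_eq0 deg_neq0.
have dE := degE v0; rewrite -/d in dE.
wlog ad : a b Aab dE {degE} / d%:R = a => [wl|].
  have [/esym da|/esym db] := Aab _ (regular_eigenvalue e_regular n_gt0).
    exact: (wl a b).
  apply: (wl b a) => //; last by rewrite mulrC.
  by move=> x /Aab[]; [right | left].
exists d; apply/laplacian_sqr_regular => //.
suff -> : -1 = b by rewrite ad; apply: normalmx_sub_mul0 adjacency_normal Aab.
apply: (mulfI d_neq0); rewrite mulrN1 {1}dE opprK ad //.
Qed.

End Graphs.

Theorem theorem4p5 (R : realType) (n k : nat) (e : rel 'I_n)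
    (F : 'I_n -> 'rV[R[i]]_k) :
  (1 <= n)%N ->
  simple_graph e ->
  (forall v : 'I_n, ~ null_vertex e v) ->
  graph_frame e F ->
  is_tight_frame F <-> two_distinct_eigenvalues R e.
Proof.
move=> n_gt0 e_simple no_null [Ff gramE].
have deg_neq0 v : degree e v != 0%N by apply/eqP/no_null.
split=> [/(tight_frame_gramian_sq Ff)[c [_]] | [a [b [_ ab]]]].
  by rewrite gramE; apply: two_eigenvalues_of_laplacian_sqr.
apply/(tight_frame_gramian_sq Ff); rewrite gramE.
have [|d L2] := laplacian_sqr_of_two_eigenvalues e_simple n_gt0 deg_neq0 (a := a) (b := b).
  by move=> x /ab.
by exists d.+1%:R; rewrite rmorph_nat.
Qed.
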